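(* Consider $\ell_2$-adversarial least squares with an arbitrary covariance $K$ (any number of distinct eigenvalues). For $1\le j\le d$ define $$s_j^\star=\begin{cases}\dfrac{\lambda_j}{\lambda_j+\tilde\lambda_\star},&0<\lambda_j+\tilde\lambda_\star<\infty,\\0,&\lambda_j=\tilde\lambda_\star=0\text{ or }\tilde\lambda_\star=\infty,\end{cases}\qquad \vartheta_j^\star(t)=\begin{cases}(\tilde\lambda_\star-\tilde\lambda^{\mathrm{eff}}(t))s_j^\star,&\tilde\lambda_\star<\infty,\\ \lambda_j,&\tilde\lambda_\star=\infty.\end{cases}$$ Then for all $t\ge0$ with $\widehat{\mathsf B}_{44}(t)>0$ the deterministic equivalent of the Polyak stepsize is $$\gamma^{\mathrm{Polyak,Adv}}(t)=\frac{\Phi_{\tilde\lambda^{\mathrm{Polyak}}(t)}(t)-\Phi_{\min}(\tilde\lambda_\star)}{\frac{\operatorname{Tr}(K)}d\,\Phi_{\tilde\lambda^{\mathrm{eff}}(t)}(t)},\qquad\text{where}\quad \tilde\lambda^{\mathrm{Polyak}}(t)=\tilde\lambda^{\mathrm{eff}}(t)+\sum_{j=1}^d\vartheta_j^\star(t)\frac{\mathsf V_{j,12}(t)}{\widehat{\mathsf B}_{44}(t)}.$$ Here $\Phi_\ell(t)=\mathsf R(t)+\frac\ell2\widehat{\mathsf B}_{44}(t)$ is the ridge regression objective with parameter $\ell$, $\Phi_{\min}(\ell)=\frac12\sum_{j:\lambda_j>0}\lambda_j\frac{\ell}{\lambda_j+\ell}\mathsf V_{j,22}+\frac{\eta^2}2$,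 and when $\tilde\lambda_\star=\infty$, $\Phi_{\min}(\tilde\lambda_\star)=\lim_{\ell\to\infty}\Phi_{\min}(\ell)=\frac{\eta^2}2+\frac12(X^\star)^\top KX^\star$.
   Context: Setting: $\ell_2$-adversarial least squares on a single class $a\sim\mathcal N(0,K)$, $K\in\mathbb R^{d\times d}$ symmetric positive semidefinite and nonzero with orthonormal eigenpairs $(\lambda_j,\omega_j)_{1\le j\le d}$, target $(X^\star)^\top a+\epsilon$, $\epsilon\sim\mathcal N(0,\eta^2)$, no explicit ridge penalty, adversarial radius $\delta>0$, initialization $X_0$. The deterministic limit of SGD with learning rate $\gamma(t)$ is the ODE system for $\mathsf V_{j,11}$, $\mathsf V_{j,12}=\mathsf V_{j,21}$, with $\mathsf V_{j,22}\equiv\langle X^\star,\omega_j\rangle^2$, $\mathsf V_{j,11}(0)=\langle X_0,\omega_j\rangle^2$, $\mathsf V_{j,12}(0)=\langle X_0,\omega_j\rangle\langle X^\star,\omega_j\rangle$: $$\dot{\mathsf V}_{j,11}=-2\tilde\gamma^{\mathrm{eff}}(\lambda_j+\tilde\lambda^{\mathrm{eff}})\mathsf V_{j,11}+2\tilde\gamma^{\mathrm{eff}}\lambda_j\mathsf V_{j,12}+2\lambda_j\frac{\gamma^2}d\mathsf R^{\mathrm{Adv}},\qquad \dot{\mathsf V}_{j,12}=-\tilde\gamma^{\mathrm{eff}}(\lambda_j+\tilde\lambda^{\mathrm{eff}})\mathsf V_{j,12}+\tilde\gamma^{\mathrm{eff}}\lambda_j\mathsf V_{j,22},$$ where $$\mathsf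 R=\tfrac12\sum_j\lambda_j(\mathsf V_{j,11}-2\mathsf V_{j,12}+\mathsf V_{j,22})+\tfrac{\eta^2}2,\quad\widehat{\mathsf B}_{44}=\sum_j\mathsf V_{j,11},\quad \mathsf R^{\mathrm{Adv}}=\mathsf R+\delta\sqrt{\tfrac2\pi}\sqrt{2\widehat{\mathsf B}_{44}\mathsf R}+\tfrac{\delta^2}2\widehat{\mathsf B}_{44},$$ $q=\sqrt{\widehat{\mathsf B}_{44}/(2\mathsf R)}$, $\tilde\gamma^{\mathrm{eff}}=\gamma(1+\delta\sqrt{2/\pi}\,q)$, $\tilde\lambda^{\mathrm{eff}}=\dfrac{\delta^2+\delta\sqrt{2/\pi}\,q^{-1}}{1+\delta\sqrt{2/\pi}\,q}$ (with $\mathsf R>0$). The adversarial risk is $\mathcal R^{\mathrm{Adv}}(X)=\mathcal R(X)+\delta\sqrt{2/\pi}\|X\|\sqrt{2\mathcal R(X)}+\frac{\delta^2}2\|X\|^2$, $\mathcal R(X)=\frac12(X-X^\star)^\top K(X-X^\star)+\frac{\eta^2}2$, with minimizer $X^{\star,\mathrm{Adv}}$. The number $\tilde\lambda_\star\in[0,\infty]$ is the ridge parameter of this minimizer: $X^{\star,\mathrm{Adv}}=\sum_{j:\lambda_j>0}\frac{\lambda_j}{\lambda_j+\tilde\lambda_\star}\langle X^\star,\omega_j\rangle\omega_j$ (equal to $0$ if $\tilde\lambda_\star=\infty$). In the noiseless case ($\eta=0$, $(X^\star)^\top KX^\star>0$), writing $x_j^\star=\langle X^\star,\omega_j\rangle$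 and all sums over $\{j:\lambda_j>0\}$, $\delta_-=\sqrt{\tfrac2\pi}\sqrt{\sum (x_j^\star)^2/\sum\lambda_j^{-1}(x_j^\star)^2}$ and $\delta_+=\sqrt{\tfrac\pi2}\sqrt{\sum\lambda_j^2(x_j^\star)^2/\sum\lambda_j(x_j^\star)^2}$: $\tilde\lambda_\star=0$ if $\delta\le\delta_-$, $\tilde\lambda_\star=\infty$ if $\delta\ge\delta_+$, and for $\delta_-<\delta<\delta_+$ it is the unique positive solution, together with $q_\star>0$, of $q_\star^2=\frac{\sum\lambda_j^2(\lambda_j+\tilde\lambda_\star)^{-2}(x_j^\star)^2}{\sum\lambda_j\tilde\lambda_\star^2(\lambda_j+\tilde\lambda_\star)^{-2}(x_j^\star)^2}$, $\tilde\lambda_\star=\frac{\delta^2+\delta\sqrt{2/\pi}/q_\star}{1+\delta\sqrt{2/\pi}q_\star}$. Let $\mathsf U_j$ be the deterministic equivalent of $\langle X,\omega_j\rangle\langle X^{\star,\mathrm{Adv}},\omega_j\rangle$: $\dot{\mathsf U}_j=-\tilde\gamma^{\mathrm{eff}}(\lambda_j+\tilde\lambda^{\mathrm{eff}})\mathsf U_j+\tilde\gamma^{\mathrm{eff}}\lambda_j\langle X^\star,\omega_j\rangle\langle X^{\star,\mathrm{Adv}},\omega_j\rangle$, $\mathsf U_j(0)=\langle X_0,\omega_j\rangle\langle X^{\star,\mathrm{Adv}},\omega_j\rangle$, and $\mathsf D^{2,\mathrm{Adv}}=\sum_j(\mathsf V_{j,11}-2\mathsf U_j)+\|X^{\star,\mathrm{Adv}}\|^2$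 (deterministic equivalent of $\|X-X^{\star,\mathrm{Adv}}\|^2$). The deterministic equivalent of the Polyak stepsize, $\gamma^{\mathrm{Polyak,Adv}}(t)$, is the value of the instantaneous learning rate $\gamma=\gamma(t)$ minimizing $\frac{d}{dt}\mathsf D^{2,\mathrm{Adv}}(t)$ at the given state; it equals $$\frac{2\mathsf R-\eta^2-\sum_j\lambda_j\big(\mathsf U_j-\mathsf V_{j,12}-\langle X^\star,\omega_j\rangle\langle X^{\star,\mathrm{Adv}},\omega_j\rangle+\mathsf V_{j,22}\big)+\tilde\lambda^{\mathrm{eff}}\big(\widehat{\mathsf B}_{44}-\sum_j\mathsf U_j\big)}{\frac{\operatorname{Tr}K}d\big(2\mathsf R+\tilde\lambda^{\mathrm{eff}}\widehat{\mathsf B}_{44}\big)}.$$ *)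

(* Defs.v *)
From HB Require Import structures.
From mathcomp Require Import all_boot all_order all_algebra.
From mathcomp Require Import all_classical all_reals all_analysis.

Set Implicit Arguments.
Unset Strict Implicit.
Unset Printing Implicit Defensive.

Import Order.TTheory GRing.Theory Num.Theory.
Import numFieldNormedType.Exports.

Local Open Scope classical_set_scope.
Local Open Scope ring_scope.

(* MathComp-Analysis norms matrices by the sup norm, so the Euclidean structure
   of R^d is spelled out. *)
Definition dotv (R : realType) (d : nat) (x y : 'cV[R]_d) : R :=
  (x^T *m y) 0 0.

Definition norm2 (R : realType) (d : nat) (x : 'cV[R]_d) : R :=
  Num.sqrt (dotv x x).

Record problem (R : realType) (d : nat) := Problem {
  cov : 'M[R]_d;                  (* K *)
  eigval : 'I_d -> R;             (* lambda_j *)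
  eigvec : 'I_d -> 'cV[R]_d;      (* omega_j *)
  target : 'cV[R]_d;              (* X^star *)
  noise : R;                      (* eta, the noise standard deviation *)
  delta : R                       (* adversarial radius *)
}.

(* Values of (V_{j,11}, V_{j,12}, U_j) at one time; V_{j,22} is constant. *)
Record state (R : realType) (d : nat) := State {
  v11 : 'I_d -> R;
  v12 : 'I_d -> R;
  uu : 'I_d -> R
}.

Section AdversarialLeastSquares.
Context {R : realType} {d : nat}.
Implicit Types (P : problem R d) (s : state R d) (X Xadv : 'cV[R]_d).
Implicit Types (g h l : R) (lstar : \bar R) (j : 'I_d).

Definition orthonormal_eigenbasis P : Prop :=
  (forall j, cov P *m eigvec P j = eigval P j *: eigvec P j) /\
  (forall i j, dotv (eigvec P i) (eigvec P j) = (i == j)%:R).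

Definition risk P X : R :=
  dotv (X - target P) (cov P *m (X - target P)) / 2 + noise P ^+ 2 / 2.

Definition adv_risk P X : R :=
  risk P X
  + delta P * Num.sqrt (2 / pi) * norm2 X * Num.sqrt (2 * risk P X)
  + delta P ^+ 2 / 2 * norm2 X ^+ 2.

Definition adv_minimizer P Xadv : Prop :=
  forall X, adv_risk P Xadv <= adv_risk P X.

Definition ridge_solution P lstar : 'cV[R]_d :=
  if lstar is r%:E then
    \sum_(j < d | 0 < eigval P j)
      (eigval P j / (eigval P j + r) * dotv (target P) (eigvec P j))
        *: eigvec P j
  else 0.

Definition ridge_parameter P Xadv lstar : Prop :=
  (0 <= lstar)%E /\ Xadv = ridge_solution P lstar.

Definition v22 P j : R := dotv (target P) (eigvec P j) ^+ 2.

Definition Rdet P s : R :=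
  (\sum_(j < d) eigval P j * (v11 s j - 2 * v12 s j + v22 P j)) / 2
  + noise P ^+ 2 / 2.

Definition B44 s : R := \sum_(j < d) v11 s j.

Definition RAdv P s : R :=
  Rdet P s
  + delta P * Num.sqrt (2 / pi) * Num.sqrt (2 * B44 s * Rdet P s)
  + delta P ^+ 2 / 2 * B44 s.

Definition qratio P s : R := Num.sqrt (B44 s / (2 * Rdet P s)).

(* The effective learning rate when the learning rate is g. *)
Definition gamma_eff P g s : R :=
  g * (1 + delta P * Num.sqrt (2 / pi) * qratio P s).

(* If B44 s = 0 then q = 0 and its inverse evaluates to 0, so that this is
   delta ^ 2. This matters for an initialization X_0 = 0: there v11, v12 and
   uu, which are what lambda_eff multiplies in the flow, all vanish. *)
Definition lambda_eff P s : R :=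
  (delta P ^+ 2 + delta P * Num.sqrt (2 / pi) * (qratio P s)^-1)
  / (1 + delta P * Num.sqrt (2 / pi) * qratio P s).

Definition flow11 P g s j : R :=
  - 2 * gamma_eff P g s * (eigval P j + lambda_eff P s) * v11 s j
  + 2 * gamma_eff P g s * eigval P j * v12 s j
  + 2 * eigval P j * (g ^+ 2 / d%:R) * RAdv P s.

Definition flow12 P g s j : R :=
  - gamma_eff P g s * (eigval P j + lambda_eff P s) * v12 s j
  + gamma_eff P g s * eigval P j * v22 P j.

Definition flowU P Xadv g s j : R :=
  - gamma_eff P g s * (eigval P j + lambda_eff P s) * uu s j
  + gamma_eff P g s * eigval P j
    * (dotv (target P) (eigvec P j) * dotv Xadv (eigvec P j)).

(* Classical solution on [0, +oo[ : continuous there, and satisfying the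
   equations at every t > 0. *)
Definition adv_dynamics P X0 Xadv (gamma : R -> R)
    (sol : R -> state R d) : Prop :=
  [/\ (forall j,
         [/\ v11 (sol 0) j = dotv X0 (eigvec P j) ^+ 2,
             v12 (sol 0) j
               = dotv X0 (eigvec P j) * dotv (target P) (eigvec P j)
           & uu (sol 0) j = dotv X0 (eigvec P j) * dotv Xadv (eigvec P j)]),
      (forall j,
         [/\ {within `[0, +oo[, continuous (fun t : R => v11 (sol t) j)},
             {within `[0, +oo[, continuous (fun t : R => v12 (sol t) j)}
           & {within `[0, +oo[, continuous (fun t : R => uu (sol t) j)}])
    & (forall (t : R) j, 0 < t ->
         [/\ is_derive t (1 : R) (fun x : R => v11 (sol x) j)
               (flow11 P (gamma t) (sol t) j),
             is_derive t (1 : R) (fun x : R => v12 (sol x) j)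
               (flow12 P (gamma t) (sol t) j)
           & is_derive t (1 : R) (fun x : R => uu (sol x) j)
               (flowU P Xadv (gamma t) (sol t) j)])].

Definition dist2 Xadv s : R :=
  \sum_(j < d) (v11 s j - 2 * uu s j) + norm2 Xadv ^+ 2.

(* The state s moved for a time h with the velocity that the dynamics prescribe
   at s under learning rate g. *)
Definition euler_step P Xadv g s h : state R d :=
  State (fun j => v11 s j + h * flow11 P g s j)
        (fun j => v12 s j + h * flow12 P g s j)
        (fun j => uu s j + h * flowU P Xadv g s j).

(* d/dt of dist2 at state s as a function of the instantaneous learning rate,
   i.e. the derivative of dist2 along the velocity field. *)
Definition dist2_rate P Xadv s g : R :=
  derive1 (fun h : R => dist2 Xadv (euler_step P Xadv g s h)) 0.

Definition polyak_stepsize P Xadv s g : Prop :=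
  forall g', dist2_rate P Xadv s g <= dist2_rate P Xadv s g'.

Definition s_star P lstar j : R :=
  if lstar is r%:E then
    if 0 < eigval P j + r then eigval P j / (eigval P j + r) else 0
  else 0.

Definition theta_star P lstar s j : R :=
  if lstar is r%:E then (r - lambda_eff P s) * s_star P lstar j
  else eigval P j.

Definition lambda_polyak P lstar s : R :=
  lambda_eff P s + \sum_(j < d) theta_star P lstar s j * (v12 s j / B44 s).

Definition Phi P l s : R := Rdet P s + l / 2 * B44 s.

Definition Phi_min P lstar : R :=
  if lstar is r%:E then
    (\sum_(j < d | 0 < eigval P j)
        eigval P j * (r / (eigval P j + r)) * v22 P j) / 2 + noise P ^+ 2 / 2
  else noise P ^+ 2 / 2 + dotv (target P) (cov P *m target P) / 2.

End AdversarialLeastSquares.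

(* Main.v *)
(* The product s*_j V_{j,12} solves the same linear equation as U_j with the
   same initial value; the decay coefficient is nonnegative, so the square of
   the difference is nonincreasing and U_j = s*_j V_{j,12}. The time derivative
   of the squared distance is a quadratic polynomial in the learning rate with
   positive leading coefficient (2 Tr K / d) R^Adv, and the factor
   1 + delta sqrt(2/pi) q cancels at its vertex because
   R^Adv = (1 + delta sqrt(2/pi) q) Phi_{lambda_eff}. *)
Require Import Defs.
From HB Require Import structures.
From mathcomp Require Import all_boot all_order all_algebra.
From mathcomp Require Import all_classical all_reals all_analysis.
From mathcomp Require Import ring lra.

Set Implicit Arguments.
Unset Strict Implicit.
Unset Printing Implicit Defensive.

Import Order.TTheory GRing.Theory Num.Theory.
Import numFieldNormedType.Exports.

Local Open Scope classical_set_scope.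
Local Open Scope ring_scope.

(** * Uniqueness for linear decay equations *)

Section NonnegativeDecay.
Context {R : realType}.
Implicit Types (f c : R -> R).

(** An integrating factor would call for an integrable [c]. The derivative of the square,
    [- 2 * c * f ^+ 2], has a sign as soon as [c] has one, so the learning rate may be any
    nonnegative function. *)
Lemma decay_eq0 f c : f 0 = 0 ->
  {within `[0, +oo[, continuous f} ->
  (forall t : R, 0 < t -> is_derive t (1 : R) f (- c t * f t)) ->
  (forall t : R, 0 < t -> 0 <= c t) ->
  forall t : R, 0 <= t -> f t = 0.
Proof.
move=> f0 cf df c_ge0 t t_ge0; apply/eqP; rewrite -sqrf_eq0 eq_le sqr_ge0 andbT.
have df2 (x : R) : 0 < x ->
    is_derive x (1 : R) (fun y => f y * f y) (- 2 * c x * (f x * f x)).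
  move=> /df dfx; apply: (is_derive_eq (is_deriveM dfx dfx)).
  by rewrite /GRing.scale /=; ring.
suff : f t * f t <= f 0 * f 0 by rewrite f0 mulr0 expr2.
apply: (@ler0_derive1_nincry R (fun y => f y * f y) 0) => //.
- by move=> x; rewrite in_itv /= andbT => /df2 [].
- move=> x; rewrite in_itv /= andbT => x_gt0.
  rewrite derive1E; have [_ ->] := df2 _ x_gt0.
  by rewrite !mulNr oppr_le0 mulr_ge0 -?expr2 ?sqr_ge0 ?mulr_ge0 ?c_ge0.
- by move=> x; apply: cvgM; exact: cf.
Qed.

End NonnegativeDecay.

Section Quadratic.
Context {R : realType}.

(** Completing the square: the excess of [f] over its value at [b / a] is [a * (g - b / a) ^+ 2],
    which gives both minimality and uniqueness. *)
Lemma quadratic_argmin (f : R -> R) (a b : R) : 0 < a ->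
  (forall g, f g = a * g ^+ 2 - 2 * b * g) ->
  forall g, (forall g', f g <= f g') <-> g = b / a.
Proof.
move=> a_gt0 fE.
have a_neq0 : a != 0 by rewrite gt_eqF.
have vertex g : f g - f (b / a) = a * (g - b / a) ^+ 2.
  by rewrite !fE; field.
move=> g; split=> [/(_ (b / a))|-> g']; last first.
  by rewrite -subr_ge0 vertex mulr_ge0 ?sqr_ge0 // ltW.
rewrite -subr_le0 vertex pmulr_rle0 // => sq_le0; apply/eqP.
by rewrite -subr_eq0 -sqrf_eq0 eq_le sq_le0 sqr_ge0.
Qed.

End Quadratic.

(** * Spectral decomposition of the covariance and the ridge family *)

Section Eigenbasis.
Context {R : realType} {d : nat}.
Variable P : problem R d.
Hypothesis eigen : orthonormal_eigenbasis P.

Lemma dotvC (x y : 'cV[R]_d) : dotv x y = dotv y x.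
Proof. by rewrite /dotv !mxE; apply: eq_bigr => i _; rewrite !mxE mulrC. Qed.

Lemma dotvZl (a : R) (x y : 'cV[R]_d) : dotv (a *: x) y = a * dotv x y.
Proof. by rewrite /dotv linearZ /= -scalemxAl mxE. Qed.

Lemma dotv0l (y : 'cV[R]_d) : dotv 0 y = 0.
Proof. by rewrite /dotv trmx0 mul0mx mxE. Qed.

Lemma dotv_suml (I : finType) (p : pred I) (F : I -> 'cV[R]_d) (y : 'cV[R]_d) :
  dotv (\sum_(i | p i) F i) y = \sum_(i | p i) dotv (F i) y.
Proof. by rewrite /dotv linear_sum mulmx_suml summxE. Qed.

Let W : 'M[R]_d := \matrix_(i, j) eigvec P j i 0.
Let D : 'rV[R]_d := \row_j eigval P j.

Let trW_mul (x : 'cV[R]_d) j : (W^T *m x) j 0 = dotv x (eigvec P j).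
Proof.
rewrite dotvC /dotv !mxE; apply: eq_bigr => i _.
by rewrite !mxE.
Qed.

Let WtW : W^T *m W = 1%:M.
Proof.
apply/matrixP => i j; rewrite !mxE -(eigen.2 i j) /dotv mxE.
by apply: eq_bigr => k _; rewrite !mxE.
Qed.

Let cov_diag : cov P = W *m diag_mx D *m W^T.
Proof.
(* As [W] is square, [WtW] also gives [W *m W^T = 1%:M]. It remains to compare [cov P *m W] with
   [W *m diag_mx D], which is the eigenvector equation column by column. *)
rewrite -[LHS]mulmx1 -(mulmx1C WtW) mulmxA; congr (_ *m _).
apply/matrixP => i j; have /matrixP/(_ i 0) := eigen.1 j.
rewrite mul_mx_diag !mxE [_ * eigvec P j i 0]mulrC => <-.
by apply: eq_bigr => k _; rewrite mxE.
Qed.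

Lemma mxtrace_cov : \tr (cov P) = \sum_j eigval P j.
Proof.
rewrite cov_diag mxtrace_mulC mulmxA WtW mul1mx mxtrace_diag.
by apply: eq_bigr => j _; rewrite mxE.
Qed.

Lemma cov_quadratic (x : 'cV[R]_d) :
  dotv x (cov P *m x) = \sum_j eigval P j * dotv x (eigvec P j) ^+ 2.
Proof.
rewrite cov_diag -!mulmxA {1}/dotv mulmxA mxE; apply: eq_bigr => j _.
have -> : (x^T *m W) 0 j = dotv x (eigvec P j).
  by rewrite /dotv !mxE; apply: eq_bigr => i _; rewrite !mxE.
by rewrite mul_diag_mx mxE trW_mul mxE; ring.
Qed.

Hypothesis cov_psd : forall x : 'cV[R]_d, 0 <= dotv x (cov P *m x).

Lemma eigval_ge0 j : 0 <= eigval P j.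
Proof.
have := cov_psd (eigvec P j).
by rewrite eigen.1 dotvC dotvZl eigen.2 eqxx mulr1.
Qed.

Lemma mxtrace_cov_gt0 : cov P != 0 -> 0 < \tr (cov P).
Proof.
move=> cov_neq0; rewrite lt_def mxtrace_cov sumr_ge0 ?andbT; last first.
  by move=> j _; exact: eigval_ge0.
apply: contra cov_neq0; rewrite psumr_eq0 => [/allP eig0|j _]; last first.
  exact: eigval_ge0.
rewrite cov_diag (_ : D = 0) ?linear0 ?mulmx0 ?mul0mx //.
by apply/rowP => j; rewrite !mxE; apply/eqP/eig0/mem_index_enum.
Qed.

Lemma dotv_ridge lstar j : (0 <= lstar)%E ->
  dotv (ridge_solution P lstar) (eigvec P j)
  = s_star P lstar j * dotv (target P) (eigvec P j).
Proof.
case: lstar => [r r_ge0| _|//] /=; last by rewrite dotv0l mul0r.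
rewrite dotv_suml; under eq_bigr do rewrite dotvZl eigen.2.
have [lj_gt0|] := ltP 0 (eigval P j).
  rewrite (bigD1 j) //= eqxx mulr1 big1 ?addr0 => [|i /andP[_ /negPf ->]].
    by rewrite ltr_pwDl.
  by rewrite mulr0.
move=> lj_le0; have -> : eigval P j = 0.
  by apply/eqP; rewrite eq_le lj_le0 eigval_ge0.
(* At a zero eigenvalue both branches of [s_star] give 0, and the ridge sum has no term of index
   [j]. *)
rewrite mul0r if_same mul0r big1 // => i.
have [->|_] := eqVneq i j; last by rewrite mulr0.
by move=> /lt_le_trans/(_ lj_le0); rewrite ltxx.
Qed.

(** Since [r / (eigval P j + r)] is [1 - s_star], one formula covers finite and infinite parameters;
    zero eigenvalues may be summed over because they carry the factor [eigval P j]. *)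
Lemma Phi_minE lstar : (0 <= lstar)%E ->
  Phi_min P lstar =
  (\sum_j eigval P j * (1 - s_star P lstar j) * v22 P j) / 2 + noise P ^+ 2 / 2.
Proof.
case: lstar => [r| _|//] /=; last first.
  rewrite addrC; congr (_ / 2 + _); rewrite cov_quadratic.
  by apply: eq_bigr => j _; rewrite subr0 mulr1.
rewrite lee_fin => r_ge0; congr (_ / 2 + _).
rewrite big_mkcond /=; apply: eq_bigr => j _.
have [lj_gt0|lj_le0] := ltP 0 (eigval P j).
  have ljr_gt0 : 0 < eigval P j + r by rewrite ltr_pwDl.
  rewrite ljr_gt0; congr (_ * _ * _); apply/eqP.
  by rewrite eq_sym subr_eq -mulrDl addrC divff // gt_eqF.
have -> : eigval P j = 0 by apply/eqP; rewrite eq_le lj_le0 eigval_ge0.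
by rewrite !mul0r.
Qed.

(** Each [s_star] tends to 0, and the limit passes through the finite sum of [Phi_minE]; that
    formula asks for [0 <= r], hence the eventual equality. *)
Lemma cvg_Phi_min : Phi_min P r%:E @[r --> +oo] --> Phi_min P +oo%E.
Proof.
have s_cvg0 j : s_star P r%:E j @[r --> +oo] --> (0 : R).
  have: eigval P j * (eigval P j + r)^-1 @[r --> +oo] --> eigval P j * 0.
    apply: cvgM; first exact: cvg_cst.
    apply/gtr0_cvgV0; last exact: cvg_addrl.
    by near=> r; rewrite ltr_wpDl ?eigval_ge0.
  rewrite mulr0; apply: cvg_trans; apply: near_eq_cvg.
  by near=> r; rewrite /s_star ltr_wpDl ?eigval_ge0.
rewrite (@Phi_minE +oo%E) //.
have: (\sum_j eigval P j * (1 - s_star P r%:E j) * v22 P j) / 2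
    + noise P ^+ 2 / 2 @[r --> +oo] -->
    (\sum_j eigval P j * (1 - 0) * v22 P j) / 2 + noise P ^+ 2 / 2.
  apply: cvgD; last exact: cvg_cst.
  apply: cvgM; last exact: cvg_cst.
  apply: cvg_big => //; first exact: add_continuous.
  move=> j _; apply: cvgM; last exact: cvg_cst.
  apply: cvgM; first exact: cvg_cst.
  by apply: cvgB => //; exact: cvg_cst.
apply: cvg_trans; apply: near_eq_cvg.
by near=> r; rewrite Phi_minE // lee_fin; near: r; exact: nbhs_pinfty_ge.
Unshelve. all: by end_near. Qed.

End Eigenbasis.

(** * Effective parameters and the rate of the squared distance *)

Section Dynamics.
Context {R : realType} {d : nat}.
Variable P : problem R d.
Implicit Types (s : state R d) (Xadv : 'cV[R]_d).
Hypothesis delta_gt0 : 0 < delta P.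

Lemma eff_factor_gt0 s : 0 < 1 + delta P * Num.sqrt (2 / pi) * qratio P s.
Proof. by rewrite ltr_pwDl // !mulr_ge0 ?sqrtr_ge0 // ltW. Qed.

(** [Num.sqrt] is nonnegative everywhere and [0^-1 = 0], so the bound applies along the whole
    trajectory, even where [B44] vanishes. *)
Lemma lambda_eff_ge0 s : 0 <= lambda_eff P s.
Proof.
rewrite divr_ge0 ?(ltW (eff_factor_gt0 _)) // addr_ge0 ?sqr_ge0 //.
by rewrite !mulr_ge0 ?invr_ge0 ?sqrtr_ge0 // ltW.
Qed.

(** [dist2] is affine in the state, hence affine in [h] along the Euler step, and its slope is the
    rate. *)
Lemma dist2_rateE Xadv s g :
  dist2_rate P Xadv s g =
  \sum_(j < d) (flow11 P g s j - 2 * flowU P Xadv g s j).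
Proof.
set F := \sum_(j < d) _.
rewrite /dist2_rate.
have -> : (fun h => dist2 Xadv (euler_step P Xadv g s h))
    = (fun h => dist2 Xadv s + h * F).
  apply/funext => h; rewrite /dist2 addrAC mulr_sumr -big_split /=.
  by congr (_ + _); apply: eq_bigr => j _; ring.
rewrite derive1E.
have D : is_derive (0 : R) (1 : R) (cst (dist2 Xadv s) + id * cst F) F.
  apply: is_derive_eq; rewrite add0r /GRing.scale /=; ring.
by case: D.
Qed.

(** With [q = qratio P s], substituting [B44 = 2 * Rdet * q ^+ 2] removes the square root, as
    [Num.sqrt (2 * B44 * Rdet) = 2 * Rdet * q]; positivity of [B44] makes [q] invertible in
    [lambda_eff]. *)
Lemma RAdv_factor s : 0 < Rdet P s -> 0 < B44 s ->
  RAdv P s =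
  (1 + delta P * Num.sqrt (2 / pi) * qratio P s) * Phi P (lambda_eff P s) s.
Proof.
move=> R_gt0 B_gt0; set c := delta P * Num.sqrt (2 / pi).
have q_gt0 : 0 < qratio P s by rewrite sqrtr_gt0 divr_gt0 ?mulr_gt0.
have q2 : qratio P s ^+ 2 * (2 * Rdet P s) = B44 s.
  by rewrite sqr_sqrtr ?divr_ge0 ?mulr_ge0 ?ltW // divfK // gt_eqF ?mulr_gt0.
have sqrtE : Num.sqrt (2 * B44 s * Rdet P s) = 2 * Rdet P s * qratio P s.
  apply/eqP; rewrite -(eqrXn2 (n := 2)) ?sqrtr_ge0 //; last first.
    by rewrite !mulr_ge0 // ltW.
  by rewrite sqr_sqrtr ?mulr_ge0 ?ltW // -q2; apply/eqP; ring.
have f_gt0 := eff_factor_gt0 s.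
rewrite /RAdv /Phi /lambda_eff sqrtE -/c -q2; rewrite -/c in f_gt0.
by field; rewrite !gt_eqF.
Qed.

End Dynamics.

(** * The Polyak stepsize as the vertex of a parabola *)

Theorem proposition5p2 (R : realType) (d : nat) (P : problem R d)
    (X0 Xadv : 'cV[R]_d) (lstar : \bar R)
    (gamma : R -> R) (sol : R -> state R d)
    (cov_sym : (cov P)^T = cov P)
    (cov_psd : forall x : 'cV[R]_d, 0 <= dotv x (cov P *m x))
    (cov_neq0 : cov P != 0)
    (cov_eigen : orthonormal_eigenbasis P)
    (noise_ge0 : 0 <= noise P)
    (delta_gt0 : 0 < delta P)
    (Xadv_min : adv_minimizer P Xadv)
    (lstar_ridge : ridge_parameter P Xadv lstar)
    (gamma_ge0 : forall t : R, 0 <= t -> 0 <= gamma t)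
    (sol_dyn : adv_dynamics P X0 Xadv gamma sol)
    (sol_risk_gt0 : forall t : R, 0 <= t -> 0 < Rdet P (sol t)) :
  (forall t : R, 0 <= t -> 0 < B44 (sol t) ->
     forall g : R,
       polyak_stepsize P Xadv (sol t) g <->
       g = (Phi P (lambda_polyak P lstar (sol t)) (sol t) - Phi_min P lstar)
           / (\tr (cov P) / d%:R * Phi P (lambda_eff P (sol t)) (sol t))) /\
  Phi_min P r%:E @[r --> +oo] --> Phi_min P +oo%E.
Proof.
have [lstar_ge0 XadvE] := lstar_ridge.
have eig_ge0 := eigval_ge0 cov_eigen cov_psd.
split; last exact: cvg_Phi_min.
have aE j : dotv Xadv (eigvec P j)
    = s_star P lstar j * dotv (target P) (eigvec P j).
  by rewrite XadvE dotv_ridge.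
have uE t j : 0 <= t -> uu (sol t) j = s_star P lstar j * v12 (sol t) j.
  move=> t_ge0; apply/eqP; rewrite -subr_eq0; apply/eqP.
  have [init cont deriv] := sol_dyn.
  pose c x := gamma_eff P (gamma x) (sol x)
                * (eigval P j + lambda_eff P (sol x)).
  apply: (@decay_eq0 R
    (fun x => uu (sol x) j - s_star P lstar j * v12 (sol x) j) c) => //.
  - by have [_ -> ->] := init j; rewrite aE; ring.
  - have [_ c12 cU] := cont j => x.
    by apply: cvgB; [exact: cU|apply: cvgM; [exact: cvg_cst|exact: c12]].
  - move=> x x_gt0; have [_ d12 dU] := deriv x j x_gt0.
    apply: (is_derive_eq (is_deriveB dU (is_deriveZ (s_star P lstar j) d12))).
    (* The source terms cancel: by [aE] the source of [uu] is [s_star] times that of [v12]. *)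
    by rewrite /flowU /flow12 /GRing.scale /= aE /c /v22; ring.
  - move=> x x_gt0; rewrite mulr_ge0 ?addr_ge0 ?lambda_eff_ge0 //.
    by rewrite mulr_ge0 ?gamma_ge0 ?ltW ?eff_factor_gt0.
move=> t t_ge0 B_gt0 g.
have R_gt0 := sol_risk_gt0 t t_ge0.
have trK_gt0 := mxtrace_cov_gt0 cov_eigen cov_psd cov_neq0.
have d_gt0 : 0 < d%:R :> R.
  (* In dimension 0 every matrix is 0, which [cov_neq0] excludes. *)
  rewrite ltr0n lt0n; apply: contra cov_neq0 => d0.
  by apply/eqP/matrixP => i; have := ltn_ord i; rewrite [X in (_ < X)%N](eqP d0).
have := RAdv_factor delta_gt0 R_gt0 B_gt0.
have := eff_factor_gt0 delta_gt0 (sol t).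
set s := sol t in R_gt0 B_gt0 *; set f := 1 + _ => f_gt0 RAdvE.
have Phi_gt0 : 0 < Phi P (lambda_eff P s) s.
  by rewrite /Phi ltr_pwDl // mulr_ge0 ?(ltW B_gt0) // divr_ge0 // lambda_eff_ge0.
pose N := Phi P (lambda_polyak P lstar s) s - Phi_min P lstar.
(* This identity explains [theta_star]: after [uu] is replaced by [s_star * v12], the left side is,
   up to sign, the coefficient of [v12] in [2 * N]. For finite [r] it rests on
   [(eigval P j + r) * s_star = eigval P j]. *)
have coefE j :
    (eigval P j + lambda_eff P s) * s_star P lstar j + eigval P j
    = 2 * eigval P j - theta_star P lstar s j.
  case: lstar lstar_ge0 {XadvE lstar_ridge aE uE N} => [r| _|//] /=; last by ring.
  rewrite lee_fin => r_ge0; case: ifPn => [h_gt0|].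
    by field; rewrite gt_eqF.
  rewrite -leNgt => h_le0; have -> : eigval P j = 0.
    by apply/eqP; rewrite eq_le eig_ge0 andbT; have := eig_ge0 j; lra.
  by ring.
(* The right side is the part of the rate linear in the learning rate, divided by [- 2 * f].
   Multiplying by [B44] clears the quotient in [lambda_polyak], and the noise terms cancel. *)
have NE : 2 * N = \sum_j ((eigval P j + lambda_eff P s) * (v11 s j - uu s j)
    - eigval P j * v12 s j
    + eigval P j * (dotv (target P) (eigvec P j) * dotv Xadv (eigvec P j))).
  rewrite /N (Phi_minE cov_eigen cov_psd) // /Phi /lambda_polyak.
  under eq_bigr do rewrite mulrA.
  rewrite -mulr_suml [_ / B44 s]mulrC.
  set Th := \sum_j theta_star _ _ _ _ * _.
  have -> : (lambda_eff P s + (B44 s)^-1 * Th) / 2 * B44 s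
      = (lambda_eff P s * B44 s + Th) / 2 by field; rewrite gt_eqF.
  rewrite /Rdet /B44 /Th; set S1 := \sum_j _; set S2 := \sum_j _.
  set S3 := \sum_j _; set S4 := \sum_j _.
  have -> : 2 * (S1 / 2 + noise P ^+ 2 / 2 + (lambda_eff P s * S2 + S3) / 2
      - (S4 / 2 + noise P ^+ 2 / 2)) = S1 + lambda_eff P s * S2 + S3 - S4 by field.
  rewrite /S1 /S2 /S3 /S4 mulr_sumr -!big_split -sumrB /=.
  apply: eq_bigr => j _; rewrite uE // aE -/s /v22.
  have -> : theta_star P lstar s j = 2 * eigval P j
      - ((eigval P j + lambda_eff P s) * s_star P lstar j + eigval P j).
    by rewrite coefE subKr.
  by ring.
have rateE h : dist2_rate P Xadv s h =
    2 * (\tr (cov P) / d%:R * RAdv P s) * h ^+ 2 - 2 * (2 * f * N) * h.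
  rewrite dist2_rateE (_ : 2 * (2 * f * N) * h = 2 * f * h * (2 * N)); last by ring.
  rewrite NE (mxtrace_cov cov_eigen).
  rewrite [LHS](_ : _ = \sum_j eigval P j * (2 * RAdv P s / d%:R * h ^+ 2)
    - 2 * f * h * \sum_j ((eigval P j + lambda_eff P s) * (v11 s j - uu s j)
    - eigval P j * v12 s j
    + eigval P j * (dotv (target P) (eigvec P j) * dotv Xadv (eigvec P j)))).
    by rewrite -mulr_suml; ring.
  rewrite mulr_sumr -sumrB; apply: eq_bigr => j _.
  by rewrite /flow11 /flowU /gamma_eff -/f; ring.
rewrite /polyak_stepsize.
rewrite (quadratic_argmin _ rateE); last first.
  by rewrite RAdvE mulr_gt0 // mulr_gt0 ?divr_gt0 // mulr_gt0.
rewrite RAdvE -/N; suff -> : 2 * f * N / (2 * (\tr (cov P) / d%:R *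
    (f * Phi P (lambda_eff P s) s)))
  = N / (\tr (cov P) / d%:R * Phi P (lambda_eff P s) s) by [].
by field; rewrite !gt_eqF.
Qed.
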